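(* Let $D_1$ and $D_2$ be subsets of $[0,\infty)$ such that $0\in D_1\cap D_2$. Then the following statements are equivalent. (i) There are sets $A_1,A_2,A_3\subseteq[0,\infty)$ with $A_2\neq\varnothing$ such that $$\mathrm{tp}(D_1)=\mathrm{tp}(D_2)=\mathrm{tp}(A_1)+\mathrm{tp}(A_2)\,\mathrm{tp}(\mathbb Z)+\mathrm{tp}(A_3).$$ (ii) There are nonempty ultrametric spaces $(X,d_X)$, $(Y,d_Y)$ and weak similarities $\Phi_1:X\to Y$, $\Phi_2:X\to Y$ such that $D(X)=D_1$, $D(Y)=D_2$ and $\Phi_1^{-1}\circ\Phi_2$ is not an isometry. (iii) There are nonempty semimetric spaces $(X,d_X)$, $(Y,d_Y)$ and weak similarities $\Phi_1:X\to Y$, $\Phi_2:X\to Y$ such that $D(X)=D_1$, $D(Y)=D_2$ and $\Phi_1^{-1}\circ\Phi_2$ is not an isometry.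
   Context: A semimetric on a set $X$ is a function $d:X\times X\to[0,\infty)$ with $d(x,y)=d(y,x)$ and $(d(x,y)=0\Leftrightarrow x=y)$ for all $x,y\in X$; $(X,d)$ is then a semimetric space. An ultrametric is a semimetric with $d(x,y)\leqslant\max\{d(x,z),d(z,y)\}$ for all $x,y,z$. The distance set of a nonempty semimetric space is $D(X)=\{d(x,y):x,y\in X\}$. A surjective mapping $\Phi:X\to Y$ between nonempty semimetric spaces is a weak similarity if there is a strictly increasing function $f:D(Y)\to D(X)$ such that $d_X(x,y)=f(d_Y(\Phi(x),\Phi(y)))$ for all $x,y\in X$; every weak similarity is a bijection, so $\Phi^{-1}$ makes sense. An isometry is a bijection between semimetric spaces preserving distances. Subsets of $[0,\infty)$ carry the standard order, and $\mathbb Z$ is the set of integers with the standard order. The order-type $\mathrm{tp}(P)$ of a poset $P$ is the class of all posets order-isomorphic to $P$ (via a bijection $f$ with $a\leqslant b\Leftrightarrow f(a)\leqslant f(b)$). For a poset $(I,\prec)$ and posets $(P_i,\leqslant_i)$, $i\in I$, with pairwise disjoint carrier sets, the ordered sum $\sum_{i\in I}(P_i,\leqslant_i)$ is the set $\bigcup_{i\in I}P_i$ ordered by: $a\leqslant b$ iff either $a,b$ lie in the same $P_i$ and $a\leqslant_i b$, or $a\in P_i$, $b\in P_j$ with $i\neq j$ and $i\prec j$. The sum $\tau_1+\dots+\tau_n$ of order-types is the order-type of the ordered sum over $I=\{1,\dots,n\}$ (standard order) of pairwise disjoint posets $P_i$ with $\mathrm{tp}(P_i)=\tau_i$. The product $\tau\,\mathrm{tp}(I)$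 is the order-type of the ordered sum over $I$ of pairwise disjoint posets $P_i$, $i\in I$, all of order-type $\tau$. (Thus $\mathrm{tp}(A_2)\,\mathrm{tp}(\mathbb Z)$ is the type of a $\mathbb Z$-indexed ordered sum of copies of $A_2$.) *)

(* Defs.v *)
From HB Require Import structures.
From mathcomp Require Import all_boot all_order all_algebra.
From mathcomp Require Import boolp classical_sets.
From mathcomp Require Import reals.

Set Implicit Arguments.
Unset Strict Implicit.
Unset Printing Implicit Defensive.

Import Order.TTheory GRing.Theory Num.Theory.

(* A subset of a poset, seen as a type, carries the induced order; the library
   declares no such instance for [set_type]. *)
Section SubsetOrder.
Context d (T : porderType d) (A : set T).

HB.instance Definition _ := SubChoice.copy (set_type A) {x | x \in A}.
HB.instance Definition _ :=
  [SubChoice_isSubPOrder of set_type A by <: with d].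

End SubsetOrder.

Section OrderTypes.
Local Open Scope order_scope.

Definition order_iso d d' (P : porderType d) (Q : porderType d') : Prop :=
  exists f : P -> Q, bijective f /\ {mono f : x y / x <= y}.

(* An order type is a class of posets, closed under isomorphism when it is
   built from [tp], [sum_ot] and [prod_ot]. The display [d] is only a tag for
   notations and has no mathematical content. *)
Definition order_type : Type := forall d, porderType d -> Prop.

Definition tp d (P : porderType d) : order_type :=
  fun d' (Q : porderType d') => order_iso P Q.

(* The sigma type is the disjoint union of the family, and its canonical order
   is lexicographic ([Order.leEsig]), that is, the order of the ordered sum. *)
Definition ordered_sum d d' (I : porderType d) (P : I -> porderType d') :
  porderType d' := {i : I & P i}.

(* The class of the ordered sums, over {0 < ... < n - 1}, of posets P_i with
   tp P_i = tau_i. *)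
Definition sum_ot n (tau : 'I_n -> order_type) : order_type :=
  fun d (Q : porderType d) =>
    exists d' (P : 'I_n -> porderType d'),
      (forall i, tau i d' (P i)) /\ order_iso (ordered_sum P) Q.

Definition sum3_ot (tau1 tau2 tau3 : order_type) : order_type :=
  sum_ot (fun i : 'I_3 =>
    match val i with 0 => tau1 | 1 => tau2 | _ => tau3 end).

(* The product tau tp(I), for tp(I) = sigma: the summands have type tau and the
   indices are ordered as sigma. *)
Definition prod_ot (tau sigma : order_type) : order_type :=
  fun d (Q : porderType d) =>
    exists d1 (I : porderType d1) d2 (P : I -> porderType d2),
      [/\ sigma d1 I, forall i, tau d2 (P i) & order_iso (ordered_sum P) Q].

End OrderTypes.

Section Semimetric.
Local Open Scope classical_set_scope.
Local Open Scope ring_scope.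

Record semimetricSpace (R : realType) := SemimetricSpace {
  sm_sort :> Type;
  sdist : sm_sort -> sm_sort -> R;
  sdist_ge0 : forall x y, 0 <= sdist x y;
  sdistC : forall x y, sdist x y = sdist y x;
  sdist_eq0 : forall x y, sdist x y = 0 <-> x = y
}.

Definition is_ultrametric (R : realType) (X : semimetricSpace R) : Prop :=
  forall x y z : X, sdist x y <= Num.max (sdist x z) (sdist z y).

Definition distance_set (R : realType) (X : semimetricSpace R) : set R :=
  [set r | exists x y : X, sdist x y = r].

(* The scaling function D(Y) -> D(X) is a total function on R of which only the
   restriction to D(Y) matters. *)
Definition weak_similarity (R : realType) (X Y : semimetricSpace R)
    (Phi : X -> Y) : Prop :=
  (forall y, exists x, Phi x = y) /\
  exists f : R -> R,
    [/\ forall r, distance_set Y r -> distance_set X (f r),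
        forall r s, distance_set Y r -> distance_set Y s -> r < s -> f r < f s &
        forall x y, sdist x y = f (sdist (Phi x) (Phi y))].

Definition is_isometry (R : realType) (X Y : semimetricSpace R)
    (g : X -> Y) : Prop :=
  bijective g /\ forall x y, sdist (g x) (g y) = sdist x y.

(* For a bijective Phi1, Psi is its inverse, so this says that
   Phi1^-1 \o Phi2 is not an isometry. *)
Definition inv_comp_not_isometry (R : realType) (X Y : semimetricSpace R)
    (Phi1 Phi2 : X -> Y) : Prop :=
  exists Psi : Y -> X,
    [/\ cancel Phi1 Psi, cancel Psi Phi1 & ~ is_isometry (Psi \o Phi2)].

End Semimetric.

(* Main.v *)
(** Two weak similarities X -> Y induce order isomorphisms F1, F2 from D(Y) to
    D(X), and Phi1^-1 \o Phi2 rescales distances by the automorphism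
    h = F1 \o F2^-1 of D(X). It is an isometry exactly when h is the identity,
    so (ii) and (iii) both say that D1 and D2 are isomorphic chains with a
    nontrivial automorphism. If h moves a, say a < h a, the iterates of h
    tile the convex hull of the orbit of a by copies of [a, h a[, which gives
    A1 + A2 Z + A3 with A1 and A3 the elements below and above the orbit.
    Conversely the shift of Z is a nontrivial automorphism of such a sum, and it
    is realised on D1 itself with the ultrametric d(x, y) = max(x, y), x <> y,
    whose distances to 0 recover the points. *)
Require Import Defs.
From mathcomp Require Import all_boot all_order all_algebra.
From mathcomp Require Import boolp classical_sets.
From mathcomp Require Import reals.
Import Order.TTheory GRing.Theory Num.Theory.
Local Open Scope classical_set_scope.
Local Open Scope ring_scope.

Set Implicit Arguments.
Unset Strict Implicit.
Unset Printing Implicit Defensive.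

(** * Order isomorphisms and equality of order types *)

Lemma surj_mono_bij d d' (P : porderType d) (Q : porderType d') (f : P -> Q) :
  {mono f : x y / (x <= y)%O} -> (forall y, exists x, f x = y) -> bijective f.
Proof.
move=> f_mono /choice [g gK]; exists g => // x.
by apply: (inc_inj f_mono); rewrite gK.
Qed.

Lemma can_mono_le d d' (P : porderType d) (Q : porderType d')
    (f : P -> Q) (g : Q -> P) :
  {mono f : x y / (x <= y)%O} -> cancel g f -> {mono g : x y / (x <= y)%O}.
Proof. by move=> f_mono gK x y; rewrite -f_mono !gK. Qed.

Lemma order_iso_refl d (P : porderType d) : order_iso P P.
Proof. by exists id; split=> //; exists id. Qed.

Lemma order_iso_sym d d' (P : porderType d) (Q : porderType d') :
  order_iso P Q -> order_iso Q P.
Proof.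
move=> [f [[g fK gK] f_mono]]; exists g; split; first by exists f.
exact: can_mono_le gK.
Qed.

Lemma order_iso_trans d1 d2 d3 (P : porderType d1) (Q : porderType d2)
    (S : porderType d3) :
  order_iso P Q -> order_iso Q S -> order_iso P S.
Proof.
move=> [f [f_bij f_mono]] [g [g_bij g_mono]]; exists (g \o f).
by split; [exact: bij_comp | move=> x y /=; rewrite g_mono f_mono].
Qed.

(** Order types are predicates on posets, so their equality comes from extensionality; conversely,
    evaluating both classes at [Q] recovers an isomorphism. *)
Lemma tp_eqP d d' (P : porderType d) (Q : porderType d') :
  tp P = tp Q <-> order_iso P Q.
Proof.
split=> [eqPQ|PQ].
  have: tp Q Q by exact: order_iso_refl.
  by rewrite -eqPQ.
apply: functional_extensionality_dep => e; apply: functional_extensionality_dep => S.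
apply: propext; split; apply: order_iso_trans => //.
exact: order_iso_sym.
Qed.

(** * Maps between ordered sums *)

(** The lexicographic order consults the second components only when the tags agree, so a map out of
    a sum can be tested inside each summand and across distinct summands separately. *)
Lemma ordered_sum_mono d d' d'' (I : porderType d) (P : I -> porderType d')
    (Q : porderType d'') (F : forall i, P i -> Q) :
  (forall i, {mono F i : x y / (x <= y)%O}) ->
  (forall i j x y, i != j -> (F i x <= F j y)%O = (i <= j)%O) ->
  {mono (fun x : ordered_sum P => F (tag x) (tagged x)) : x y / (x <= y)%O}.
Proof.
move=> F_mono F_cross [i x] [j y] /=.
have [eq_ij|neq_ij] := eqVneq i j.
  by subst j; rewrite F_mono leEsig /= lexx /= tagged_asE.
rewrite F_cross // leEsig /=; case: (boolP (i <= j)%O) => //= le_ij.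
by rewrite lt_geF // lt_neqAle neq_ij.
Qed.

Definition ordered_sum_map d1 d1' d2 d2' (I : porderType d1) (J : porderType d2)
    (P : I -> porderType d1') (Q : J -> porderType d2') (s : I -> J)
    (f : forall i, P i -> Q (s i)) (x : ordered_sum P) : ordered_sum Q :=
  existT (fun j => Q j : Type) (s (tag x)) (f (tag x) (tagged x)).

Lemma ordered_sum_map_mono d1 d1' d2 d2' (I : porderType d1) (J : porderType d2)
    (P : I -> porderType d1') (Q : J -> porderType d2') (s : I -> J)
    (f : forall i, P i -> Q (s i)) :
  {mono s : i j / (i <= j)%O} -> (forall i, {mono f i : x y / (x <= y)%O}) ->
  {mono ordered_sum_map f : x y / (x <= y)%O}.
Proof.
move=> s_mono f_mono.
apply: (@ordered_sum_mono _ _ _ _ P (ordered_sum Q)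
  (fun i u => existT (fun j => Q j : Type) (s i) (f i u))).
  by move=> i x y; rewrite leEsig /= lexx tagged_asE f_mono.
move=> i j x y neq_ij; rewrite leEsig /= !s_mono.
case: (boolP (i <= j)%O) => //= le_ij.
by rewrite lt_geF // lt_neqAle neq_ij.
Qed.

Lemma ordered_sum_map_surj d1 d1' d2 d2' (I : porderType d1) (J : porderType d2)
    (P : I -> porderType d1') (Q : J -> porderType d2') (s : I -> J)
    (f : forall i, P i -> Q (s i)) :
  (forall j, exists i, s i = j) -> (forall i y, exists x, f i x = y) ->
  forall y, exists x, ordered_sum_map f x = y.
Proof.
move=> s_surj f_surj [j y]; have [i eq_ij] := s_surj j; subst j.
by have [x <-] := f_surj i y; exists (existT (fun i => P i : Type) i x).
Qed.

Lemma ordered_sum_iso d1 d1' d2 d2' (I : porderType d1) (J : porderType d2)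
    (P : I -> porderType d1') (Q : J -> porderType d2') (s : I -> J) :
  bijective s -> {mono s : i j / (i <= j)%O} ->
  (forall i, order_iso (P i) (Q (s i))) ->
  order_iso (ordered_sum P) (ordered_sum Q).
Proof.
move=> [s' _ s'K] s_mono PQ.
pose f i := projT1 (cid (PQ i)).
have f_bij i : bijective (f i) by case: (projT2 (cid (PQ i))).
have f_mono i : {mono f i : x y / (x <= y)%O} by case: (projT2 (cid (PQ i))).
have map_mono := ordered_sum_map_mono s_mono f_mono.
exists (ordered_sum_map f); split=> //.
apply: surj_mono_bij => //; apply: ordered_sum_map_surj.
  by move=> j; exists (s' j).
by move=> i y; have [g _ gK] := f_bij i; exists (g y).
Qed.

(** The [match] copies the one in [sum3_ot], so that both reduce to the same summand once the index
    is destructed. *)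
Definition ordered_sum3 d (P1 P2 P3 : porderType d) : porderType d :=
  ordered_sum (fun i : 'I_3 =>
    match val i with 0%N => P1 | 1%N => P2 | _ => P3 end).

Definition int_sum d (P : porderType d) : porderType d :=
  ordered_sum (fun _ : int => P).

(** Sums and products of order types quantify over all representatives of the summands and of the
    index. Isomorphic choices give isomorphic ordered sums, so one concrete representative
    determines the class. *)
Lemma sum3_ot_prodE d (P1 P2 P3 : porderType d) :
  sum3_ot (tp P1) (prod_ot (tp P2) (tp int)) (tp P3) =
  tp (ordered_sum3 P1 (int_sum P2) P3).
Proof.
apply: functional_extensionality_dep => e; apply: functional_extensionality_dep => Q.
apply: propext; split=> [[d' [P [tauP PQ]]]|sumQ].
  apply: order_iso_trans PQ.
  apply: (@ordered_sum_iso _ _ _ _ _ _ _ _ id) => //; first by exists id.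
  move=> i; move: (tauP i); case: i => [[|[|[|//]]] lt_i] //=.
  case=> [d1 [J [d2 [P' [[s [s_bij s_mono]] PP' P'P]]]]].
  apply: order_iso_trans P'P.
  by apply: (@ordered_sum_iso _ _ _ _ _ _ _ _ s) => // n; apply: PP'.
exists d, (fun i : 'I_3 =>
    match val i with 0%N => P1 | 1%N => int_sum P2 | _ => P3 end).
split=> //; case=> [[|[|[|//]]] lt_i] /=; try exact: order_iso_refl.
exists _, int, d, (fun=> P2); split=> [||] *; exact: order_iso_refl.
Qed.

Lemma ordered_sum3_iso d d' (P1 P2 P3 : porderType d) (Q : porderType d')
    (F1 : P1 -> Q) (F2 : P2 -> Q) (F3 : P3 -> Q) :
  {mono F1 : x y / (x <= y)%O} -> {mono F2 : x y / (x <= y)%O} ->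
  {mono F3 : x y / (x <= y)%O} ->
  (forall x y, F1 x < F2 y)%O -> (forall x y, F2 x < F3 y)%O ->
  (forall x y, F1 x < F3 y)%O ->
  (forall q, [\/ exists x, F1 x = q, exists x, F2 x = q | exists x, F3 x = q]) ->
  order_iso (ordered_sum3 P1 P2 P3) Q.
Proof.
move=> mono1 mono2 mono3 lt12 lt23 lt13 cover.
(* Indexing by [nat] instead of ['I_3] lets the dependent matches compute once the ordinal is
   destructed. *)
pose P (n : nat) : porderType d :=
  match n with 0%N => P1 | 1%N => P2 | _ => P3 end.
pose F (n : nat) : P n -> Q :=
  match n return P n -> Q with 0%N => F1 | 1%N => F2 | _ => F3 end.
pose F' (i : 'I_3) : P (val i) -> Q := F (val i).
pose G (x : ordered_sum3 P1 P2 P3) := F' (tag x) (tagged x).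
have G_mono : {mono G : x y / (x <= y)%O}.
  apply: (@ordered_sum_mono _ _ _ _ (fun i : 'I_3 => P (val i)) Q F').
    by case=> [[|[|[|//]]] lt_i].
  move=> [[|[|[|//]]] lti] [[|[|[|//]]] ltj] //= x y _; rewrite /F' /=;
    by [apply/ltW | apply: lt_geF].
exists G; split=> //; apply: surj_mono_bij => // q.
have [[x <-]|[x <-]|[x <-]] := cover q.
- by exists (existT (fun i : 'I_3 => P (val i) : Type) (@Ordinal 3 0 isT) x).
- by exists (existT (fun i : 'I_3 => P (val i) : Type) (@Ordinal 3 1 isT) x).
- by exists (existT (fun i : 'I_3 => P (val i) : Type) (@Ordinal 3 2 isT) x).
Qed.

(** * Nontrivial automorphisms and the shift *)

Definition order_aut d (P : porderType d) (h : P -> P) : Prop :=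
  bijective h /\ {mono h : x y / (x <= y)%O}.

(** Conjugate by the isomorphism [f]: if [h] moves [x], the conjugate moves [f x]. *)
Lemma order_iso_nontrivial_aut d d' (P : porderType d) (Q : porderType d') :
  order_iso P Q ->
  (exists2 h : P -> P, order_aut h & exists x, h x <> x) ->
  exists2 h : Q -> Q, order_aut h & exists x, h x <> x.
Proof.
move=> [f [[g fK gK] f_mono]] [h [h_bij h_mono] [x hx]].
exists (f \o h \o g); last first.
  by exists (f x) => /=; rewrite fK => /(can_inj fK).
split; last by move=> u v /=; rewrite f_mono h_mono (can_mono_le f_mono gK).
by apply: bij_comp; [apply: bij_comp => //; exists g | exists f].
Qed.

(** Translate the index of the middle sum by 1 and fix the outer summands; [a] provides a point that
    moves. *)
Lemma ordered_sum3_int_shift d (P1 P2 P3 : porderType d) (a : P2) :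
  exists2 h : ordered_sum3 P1 (int_sum P2) P3 -> _, order_aut h &
    exists x, h x <> x.
Proof.
pose shift : int_sum P2 -> int_sum P2 :=
  @ordered_sum_map _ _ _ _ int int (fun=> P2) (fun=> P2)
    (fun n => n + 1) (fun=> id).
have shift_mono : {mono shift : x y / (x <= y)%O}.
  by apply: ordered_sum_map_mono => // m n; rewrite lerD2r.
have shift_surj : forall y, exists x, shift x = y.
  apply: ordered_sum_map_surj => [n|_ y]; last by exists y.
  by exists (n - 1); rewrite subrK.
pose P (n : nat) : porderType d :=
  match n with 0%N => P1 | 1%N => int_sum P2 | _ => P3 end.
pose f (n : nat) : P n -> P n :=
  match n return P n -> P n with 1%N => shift | _ => id end.
pose h := @ordered_sum_map _ _ _ _ _ _ (fun i : 'I_3 => P (val i))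
  (fun i : 'I_3 => P (val i)) id (fun i => f (val i)).
have h_mono : {mono h : x y / (x <= y)%O}.
  apply: ordered_sum_map_mono => //.
  by case=> [[|[|[|//]]] lt_i].
exists h.
  split=> //; apply: surj_mono_bij => //.
  apply: ordered_sum_map_surj => [i|]; first by exists i.
  by case=> [[|[|[|//]]] lt_i] y //; exists y.
pose u : int_sum P2 := existT (fun _ : int => P2 : Type) 0 a.
exists (existT (fun i : 'I_3 => P (val i) : Type) (@Ordinal 3 1 isT) u).
(* A fixed point in the middle summand would have equal integer tags, that is $0 + 1 = 0$. *)
by move/eqP; rewrite eq_Tagged => /eqP /(congr1 tag).
Qed.

(** * Subsets of a chain as posets *)

Section SubsetPoset.
Local Open Scope order_scope.
Context d (T : orderType d) (D : set T).
Implicit Types x y : D.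

Lemma set_leE x y : (x <= y) = (val x <= val y :> T).
Proof. exact: leEsub. Qed.

Lemma set_ltE x y : (x < y) = (val x < val y :> T).
Proof. exact: ltEsub. Qed.

(** The order on a subset is declared only as a partial order; totality is inherited through
    [val]. *)
Lemma set_leNgt x y : (x <= y) = ~~ (y < x).
Proof. by rewrite set_leE set_ltE leNgt. Qed.

Lemma set_ltNge x y : (x < y) = ~~ (y <= x).
Proof. by rewrite set_leE set_ltE ltNge. Qed.

Lemma set_elt t : D t -> exists x, val x = t.
Proof.
move=> Dt; have Dt' : t \in D by apply: mem_set.
by exists (SigSub Dt').
Qed.

(** The pieces of the decomposition are cut out inside the subtype [D] but must be delivered as
    subsets of [T]; [i] re-embeds such a subset into [D]. *)
Lemma subset_val (B : set D) :
  exists i : (val @` B : set T) -> D,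
    [/\ {mono i : u v / u <= v}, forall u, B (i u) &
        forall x, B x -> exists u, i u = x].
Proof.
have /choice [i iP] : forall u : (val @` B : set T), exists x, B x /\ val x = val u.
  by move=> u; have [x Bx eq_xu] := set_valP u; exists x.
exists i; split=> [u v|u|x Bx]; last first.
- have Bx' : (val @` B) (val x) by exists x.
  have Bx'' : val x \in val @` B by apply: mem_set.
  by exists (SigSub Bx''); apply/val_inj; have [_ ->] := iP (SigSub Bx'').
- by have [] := iP u.
- by rewrite set_leE (iP u).2 (iP v).2 -leEsub.
Qed.

End SubsetPoset.

(** * Integer powers of a bijection *)

Section IntegerIterate.
Context (T : Type) (h h' : T -> T).
Hypotheses (hK : cancel h h') (h'K : cancel h' h).

(** [Negz k] is $-(k+1)$, hence the [k.+1] iterations of the inverse. *)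
Definition iterz (n : int) (x : T) : T :=
  match n with Posz k => iter k h x | Negz k => iter k.+1 h' x end.

Lemma iterzS n x : iterz (n + 1) x = h (iterz n x).
Proof.
(* The cases are $n \geq 0$, then $n = -1$, where adding 1 changes the constructor, then $n \leq
   -2$. *)
case: n => [k|[|k]] //=; first by rewrite addn1.
by rewrite h'K subn1.
Qed.

Lemma iterzSr n x : iterz (n + 1) x = iterz n (h x).
Proof.
case: n => [k|[|k]] /=; first by rewrite addn1 -iterSr.
  by rewrite hK.
by rewrite subn1 /= -!iterS [in RHS]iterSr hK.
Qed.

Lemma iterz_surj n y : exists x, iterz n x = y.
Proof.
case: n => k /=.
  exists (iter k h' y); elim: k y => // k IHk y.
  by rewrite iterS iterSr /= IHk h'K.
exists (iter k.+1 h y); rewrite -[LHS]/(iter k.+1 h' _).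
by elim: k.+1 y => // m IHm y; rewrite iterS iterSr /= IHm hK.
Qed.

End IntegerIterate.

(** * Decomposition of a chain along an orbit *)

Section OrbitDecomposition.
Context d (T : orderType d) (D : set T) (h h' : D -> D).
Hypotheses (hK : cancel h h') (h'K : cancel h' h).
Hypothesis h_mono : {mono h : x y / (x <= y)%O}.
Variable a : D.
Hypothesis lt_a_ha : (a < h a)%O.

Local Notation hz := (iterz h h').

Lemma iterz_mono n : {mono hz n : x y / (x <= y)%O}.
Proof.
have h'_mono := can_mono_le h_mono h'K.
have iter_mono (f : D -> D) k :
    {mono f : x y / (x <= y)%O} -> {mono iter k f : x y / (x <= y)%O}.
  by move=> f_mono; elim: k => // k IHk x y; rewrite !iterS f_mono IHk.
by case: n => k x y; apply: iter_mono.
Qed.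

Lemma iterz_lt_mono n : {mono hz n : x y / (x < y)%O}.
Proof. by move=> x y; rewrite !set_ltNge iterz_mono. Qed.

Lemma iterz_orbit_lt n : (hz n a < hz (n + 1) a)%O.
Proof. by rewrite iterzSr // iterz_lt_mono. Qed.

Lemma iterz_orbit_le m n : (m <= n)%R -> (hz m a <= hz n a)%O.
Proof.
move=> le_mn; rewrite -(subrK m n) addrC.
have: (0 <= n - m)%R by rewrite subr_ge0.
case: (n - m) => // k _; elim: k => [|k IHk]; first by rewrite addr0.
apply: le_trans IHk _; rewrite -addn1 PoszD addrA.
exact/ltW/iterz_orbit_lt.
Qed.

(** A floor function along the orbit: well-ordering gives the least natural number $q$ with $t <
    h^{m+q} a$, and $k = m + q - 1$. *)
Lemma iterz_orbit_floor m n t :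
  (hz m a <= t)%O -> (t < hz n a)%O ->
  exists k, (hz k a <= t)%O /\ (t < hz (k + 1) a)%O.
Proof.
move=> le_mt lt_tn.
have lt_mn : (m < n)%R.
  rewrite ltNge; apply/negP => /iterz_orbit_le le_nm.
  by have := le_lt_trans (le_trans le_nm le_mt) lt_tn; rewrite ltxx.
have ex_p : exists p : nat, (t < hz (m + p%:Z) a)%O.
  exists `|n - m|%N; rewrite gez0_abs ?subr_ge0 1?ltW //.
  by rewrite addrCA subrr addr0.
(* The least value is not 0, because $h^m a \leq t$; written [p.+1], it yields the witness $m +
   p$. *)
case: (ex_minnP ex_p) => -[|p] lt_tp p_min.
  by rewrite addr0 set_ltNge le_mt in lt_tp.
exists (m + p%:Z); split; last by rewrite -addrA -PoszD addn1.
by rewrite set_leNgt; apply/negP => /p_min; rewrite ltnn.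
Qed.

Lemma orbit_decomposition :
  exists A1 A2 A3 : set T,
    [/\ A1 `<=` D, A2 `<=` D, A3 `<=` D & A2 !=set0] /\
    order_iso (ordered_sum3 A1 (int_sum A2) A3) D.
Proof.
pose B1 : set D := [set t | forall n, (t < hz n a)%O].
pose B2 : set D := [set t | (a <= t)%O /\ (t < h a)%O].
pose B3 : set D := [set t | forall n, (hz n a < t)%O].
have subD (B : set D) : val @` B `<=` D by move=> _ [x _ <-]; apply: set_valP.
exists (val @` B1), (val @` B2), (val @` B3).
split; first by split=> //; exists (val a), a.
have [i1 [mono1 B_i1 surj1]] := subset_val B1.
have [i2 [mono2 B_i2 surj2]] := subset_val B2.
have [i3 [mono3 B_i3 surj3]] := subset_val B3.
(* The copy of $[a, h a[$ with index $n$ is carried by $h^n$ onto $[h^n a, h^{n+1} a[$. *)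
pose F2 (x : int_sum (val @` B2 : set T)) : D := hz (tag x) (i2 (tagged x)).
have F2_ge x : (hz (tag x) a <= F2 x)%O.
  by rewrite iterz_mono; case: (B_i2 (tagged x)).
have F2_lt x : (F2 x < hz (tag x + 1) a)%O.
  by rewrite iterzSr // iterz_lt_mono; case: (B_i2 (tagged x)).
apply: (ordered_sum3_iso mono1 _ mono3 (F2 := F2)).
- apply: (@ordered_sum_mono _ _ _ int (fun=> (val @` B2 : set T)) D
    (fun n u => hz n (i2 u))); first by move=> n x y; rewrite iterz_mono mono2.
  (* For $m < n$, hence $m + 1 \leq n$: $h^m x < h^{m+1} a \leq h^n a \leq h^n y$. *)
  have F2_cross (m n : int) x y : (m < n)%R -> (hz m (i2 x) < hz n (i2 y))%O.
    move=> lt_mn.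
    apply: lt_le_trans (F2_lt (existT (fun=> _ : Type) m x)) _.
    apply: le_trans (F2_ge (existT (fun=> _ : Type) n y)).
  by apply: iterz_orbit_le; rewrite /= lezD1.
  move=> m n x y; case: (ltgtP m n) => // [lt_mn|lt_nm] _.
    exact/ltW/F2_cross.
  exact/lt_geF/F2_cross.
- by move=> x y; apply: lt_le_trans (F2_ge y); apply: B_i1.
- by move=> x y; apply: lt_trans (F2_lt x) _; apply: B_i3.
- by move=> x y; apply: lt_trans (B_i1 x 0) (B_i3 y 0).
move=> t; have [/surj1 ?|/existsNP [m le_mt]] := pselect (B1 t).
  exact: Or31.
have [/surj3 ?|/existsNP [n le_tn]] := pselect (B3 t); first exact: Or33.
have [k [le_kt lt_tk]] : exists k, (hz k a <= t)%O /\ (t < hz (k + 1) a)%O.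
  (* Failing to lie above the orbit only gives $t \leq h^n a$; passing to $n + 1$ makes the bound
     strict. *)
  apply: (@iterz_orbit_floor m (n + 1)).
    by rewrite set_leNgt; apply/negP.
  by apply: le_lt_trans (iterz_orbit_lt n); rewrite set_leNgt; apply/negP.
(* The preimage of [t] under $h^k$ lies in the fundamental interval $[a, h a[$. *)
apply: Or32; have [s eq_st] := iterz_surj hK h'K k t.
have [|x eq_xs] := surj2 s.
  split; first by rewrite -(iterz_mono k) eq_st.
  by rewrite -(iterz_lt_mono k) eq_st -iterzSr.
by exists (existT (fun=> _ : Type) k x); rewrite /F2 /= eq_xs.
Qed.

End OrbitDecomposition.

Lemma nontrivial_aut_decomposition d (T : orderType d) (D : set T) (h : D -> D) :
  order_aut h -> (exists x, h x <> x) ->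
  exists A1 A2 A3 : set T,
    [/\ A1 `<=` D, A2 `<=` D, A3 `<=` D & A2 !=set0] /\
    order_iso (ordered_sum3 A1 (int_sum A2) A3) D.
Proof.
move=> [[h' hK h'K] h_mono] [a neq_ha].
have h'_mono := can_mono_le h_mono h'K.
have [lt_aha|] := boolP (a < h a)%O.
  exact: (orbit_decomposition hK h'K h_mono lt_aha).
(* When [h] moves [a] downwards, its inverse moves [a] upwards and takes its place. *)
rewrite -set_leNgt => le_haa.
apply: (orbit_decomposition h'K hK h'_mono (a := a)).
rewrite lt_neqAle -h_mono h'K le_haa andbT.
by apply/eqP => eq_a; apply: neq_ha; rewrite [in LHS]eq_a h'K.
Qed.

(** * The maximum ultrametric and its weak similarities *)

Section MaxSpace.
Context (R : realType) (D : set R).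
Hypotheses (D_ge0 : D `<=` [set r | 0 <= r]) (D0 : D 0).

Let D_val_ge0 (x : D) : 0 <= val x.
Proof. exact/D_ge0/set_valP. Qed.

Definition max_dist (x y : D) : R :=
  if x == y then 0 else Num.max (val x) (val y).

Lemma max_dist_ge0 x y : 0 <= max_dist x y.
Proof. by rewrite /max_dist; case: eqP => // _; rewrite le_max D_val_ge0. Qed.

Lemma max_distC x y : max_dist x y = max_dist y x.
Proof. by rewrite /max_dist eq_sym maxC. Qed.

Lemma max_dist_eq0 x y : max_dist x y = 0 <-> x = y.
Proof.
split=> [|->]; rewrite /max_dist ?eqxx //; case: eqP => // _ max0.
apply: val_inj; apply/eqP; rewrite eq_le.
have lex0 : val x <= 0 by rewrite -max0 le_max lexx.
have ley0 : val y <= 0 by rewrite -max0 le_max lexx orbT.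
by rewrite (le_trans lex0) ?D_val_ge0 // (le_trans ley0) ?D_val_ge0.
Qed.

Definition max_space : semimetricSpace R :=
  SemimetricSpace max_dist_ge0 max_distC max_dist_eq0.

(** If [z] is [x] or [y], one distance on the right vanishes and the other is the left side;
    otherwise the right side is the maximum of all three values. *)
Lemma max_space_ultrametric : is_ultrametric max_space.
Proof.
move=> x y z; rewrite /=; have [->|neq_xy] := eqVneq x y.
  by rewrite [leLHS]/max_dist eqxx le_max max_dist_ge0.
rewrite /max_dist (negPf neq_xy).
have [eq_xz|_] := eqVneq x z.
  by rewrite -eq_xz (negPf neq_xy) [leRHS]max_r // le_max D_val_ge0.
have [->|_] := eqVneq z y.
  by rewrite [leRHS]max_l // le_max D_val_ge0.
by rewrite ge_max !le_max !lexx !orbT.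
Qed.

(** Distances to 0 recover the points. This makes every element of [D] a distance, and forces an
    isometry fixing 0 to be the identity. *)
Lemma max_space_zero : exists2 o : max_space,
  val o = 0 & forall x : max_space, sdist o x = val x.
Proof.
have [o o0] := set_elt D0; exists o => // x /=; rewrite /max_dist.
by case: eqP => [<-|_] //; rewrite o0; apply/max_idPr.
Qed.

Lemma distance_set_max_space : distance_set max_space = D.
Proof.
apply/seteqP; split=> [_ [x [y <-]]|r Dr] /=.
  rewrite /max_dist; case: eqP => // _.
  by rewrite /Num.max; case: ifP => _; apply: set_valP.
have [o _ o_dist] := max_space_zero; have [x <-] := set_elt Dr.
by exists o, x.
Qed.

End MaxSpace.

(** 0 is the least element on both sides, and isomorphisms preserve least elements. *)
Lemma order_iso_val0 (R : realType) (D E : set R)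
    (D_ge0 : D `<=` [set r | 0 <= r]) (E_ge0 : E `<=` [set r | 0 <= r])
    (E0 : E 0) (phi : D -> E) :
  bijective phi -> {mono phi : x y / (x <= y)%O} ->
  forall x, val x = 0 -> val (phi x) = 0.
Proof.
move=> [psi phiK psiK] phi_mono x x0; have [o o0] := set_elt E0.
apply/eqP; rewrite eq_le; apply/andP; split; last exact/E_ge0/set_valP.
rewrite -o0 -set_leE -(psiK o) phi_mono set_leE x0.
exact/D_ge0/set_valP.
Qed.

Lemma max_space_weak_similarity (R : realType) (D E : set R)
    (D_ge0 : D `<=` [set r | 0 <= r]) (D0 : D 0)
    (E_ge0 : E `<=` [set r | 0 <= r]) (E0 : E 0) (phi : D -> E) :
  bijective phi -> {mono phi : x y / (x <= y)%O} ->
  @weak_similarity R (max_space D_ge0) (max_space E_ge0) phi.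
Proof.
move=> [psi phiK psiK] phi_mono; split; first by move=> y; exists (psi y).
have psi_mono := can_mono_le phi_mono psiK.
have psi0 := order_iso_val0 E_ge0 D_ge0 D0 (Bijective psiK phiK) psi_mono.
(* Scaling goes from the target's distances back to the source's, so it is the inverse of [phi],
   with default value 0 outside [E]. *)
pose f (r : R) : R := oapp (fun y : E => val (psi y)) 0 (insub r).
have fE (y : E) : f (val y) = val (psi y) by rewrite /f valK.
exists f; rewrite !distance_set_max_space //; split.
- by move=> r /set_elt [y <-]; rewrite fE; apply: set_valP.
- move=> r s /set_elt [y <-] /set_elt [z <-]; rewrite !fE.
  by rewrite -!set_ltE !set_ltNge psi_mono.
move=> x y; rewrite /= /max_dist (inj_eq (can_inj phiK)).
(* On the diagonal the scaling must send 0 to 0; off it, the increasing map [phi] commutes with the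
   maximum. *)
case: eqP => [_|_].
  by have [o o0] := set_elt E0; rewrite -o0 fE psi0.
rewrite /Num.max -!set_ltE !set_ltNge phi_mono.
by case: ifP => _; rewrite fE phiK.
Qed.

(** * From weak similarities to automorphisms of the distance set *)

(** A strictly increasing map of chains reflects the order, and every distance of [X] is the image
    of the distance between the corresponding points of [Y]. The last clause speaks of values to
    keep membership proofs out of the statement. *)
Lemma weak_similarity_order_iso (R : realType) (X Y : semimetricSpace R)
    (Phi : X -> Y) :
  weak_similarity Phi ->
  exists F : distance_set Y -> distance_set X,
    [/\ bijective F, {mono F : r s / (r <= s)%O} &
        forall x y r, val r = sdist (Phi x) (Phi y) -> val (F r) = sdist x y].
Proof.
move=> [Phi_surj [f [f_im f_lt f_dist]]].
have /choice [F FE] : forall r : distance_set Y,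
    exists s : distance_set X, val s = f (val r).
  by move=> r; apply/set_elt/f_im/set_valP.
have F_mono : {mono F : r s / (r <= s)%O}.
  move=> r s; rewrite !set_leE !FE.
  have dr := set_valP r; have ds := set_valP s.
  case: (ltgtP (val r) (val s)) => [lt_rs|lt_sr|->]; last exact: lexx.
    exact/ltW/f_lt.
  exact/lt_geF/f_lt.
have F_dist x y r : val r = sdist (Phi x) (Phi y) -> val (F r) = sdist x y.
  by move=> eq_r; rewrite FE eq_r f_dist.
exists F; split=> //; apply: surj_mono_bij => // s.
have [x [y eq_s]] := set_valP s.
have [|r eq_r] := @set_elt _ _ (distance_set Y) (sdist (Phi x) (Phi y)).
  by exists (Phi x), (Phi y).
by exists r; apply: val_inj; rewrite (F_dist x y).
Qed.

(** If the images coincide, then $d(x,y) = f(d(\Phi y, \Phi y)) = d(y,y) = 0$. *)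
Lemma weak_similarity_inj (R : realType) (X Y : semimetricSpace R)
    (Phi : X -> Y) : weak_similarity Phi -> injective Phi.
Proof.
move=> [_ [f [_ _ f_dist]]] x y eq_xy; apply/sdist_eq0.
by rewrite f_dist eq_xy -f_dist; apply/sdist_eq0.
Qed.

Lemma weak_similarities_nontrivial_aut (R : realType) (X Y : semimetricSpace R)
    (Phi1 Phi2 : X -> Y) :
  weak_similarity Phi1 -> weak_similarity Phi2 ->
  inv_comp_not_isometry Phi1 Phi2 ->
  exists2 h : distance_set X -> distance_set X,
    order_aut h & exists r, h r <> r.
Proof.
move=> sim1 sim2 [Psi [Phi1K PsiK not_isom]].
have [F1 [bij1 mono1 dist1]] := weak_similarity_order_iso sim1.
have [F2 [[G2 F2K G2K] mono2 dist2]] := weak_similarity_order_iso sim2.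
exists (F1 \o G2).
  split; first by apply: bij_comp => //; exists F2.
  by move=> r s /=; rewrite mono1 (can_mono_le mono2 G2K).
apply: contrapT => /forallNP fix_h; apply: not_isom.
have [Phi2_surj _] := sim2; have [Phi2' Phi2'K] := choice Phi2_surj.
split.
  exists (Phi2' \o Phi1) => [x|x] /=; last by rewrite Phi2'K Phi1K.
  by apply: (weak_similarity_inj sim2); rewrite Phi2'K PsiK.
move=> x y /=.
have [|r eq_r] := @set_elt _ _ (distance_set Y) (sdist (Phi2 x) (Phi2 y)).
  by exists (Phi2 x), (Phi2 y).
(* With $r = d(\Phi_2 x, \Phi_2 y)$, the two distances to compare are [F1 r] and [F2 r]; they agree
   because $F_1 \circ F_2^{-1}$ fixes [F2 r]. *)
rewrite -(dist1 _ _ r) ?PsiK // -(dist2 _ _ r) //; congr val.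
by have := contrapT (fix_h (F2 r)); rewrite /= F2K.
Qed.

Theorem theorem3p16 (R : realType) (D1 D2 : set R)
    (hD1 : D1 `<=` [set r | 0 <= r]) (hD2 : D2 `<=` [set r | 0 <= r])
    (h0 : (D1 `&` D2) 0) :
  [<->
    (* (i) *)
    exists A1 A2 A3 : set R,
      [/\ A1 `<=` [set r | 0 <= r], A2 `<=` [set r | 0 <= r],
          A3 `<=` [set r | 0 <= r] & A2 !=set0] /\
      (tp D1 = tp D2 /\
       tp D2 = sum3_ot (tp A1) (prod_ot (tp A2) (tp int)) (tp A3));
    (* (ii) *)
    exists (X Y : semimetricSpace R) (Phi1 Phi2 : X -> Y),
      [/\ inhabited X, inhabited Y, is_ultrametric X & is_ultrametric Y] /\
      [/\ weak_similarity Phi1, weak_similarity Phi2,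
          distance_set X = D1, distance_set Y = D2 &
          inv_comp_not_isometry Phi1 Phi2];
    (* (iii) *)
    exists (X Y : semimetricSpace R) (Phi1 Phi2 : X -> Y),
      [/\ inhabited X & inhabited Y] /\
      [/\ weak_similarity Phi1, weak_similarity Phi2,
          distance_set X = D1, distance_set Y = D2 &
          inv_comp_not_isometry Phi1 Phi2]].
Proof.
have [D10 D20] := h0.
tfae.
- move=> [A1 [A2 [A3 [[_ _ _ [a A2a]] [/tp_eqP D12 tpD2]]]]].
  have /tp_eqP D2_sum := etrans tpD2 (sum3_ot_prodE A1 A2 A3).
  have [a' _] := set_elt A2a.
  (* The shift of the sum, transported to [D1], is an automorphism [k] moving [x]. *)
  have [k [k_bij k_mono] [x kx]] := order_iso_nontrivial_aut
    (order_iso_sym (order_iso_trans D12 D2_sum)) (ordered_sum3_int_shift A1 A3 a').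
  have [phi [phi_bij phi_mono]] := D12.
  have phik_mono : {mono phi \o k : x y / (x <= y)%O}.
    by move=> u v /=; rewrite phi_mono k_mono.
  have [psi phiK psiK] := phi_bij.
  have [o1 _] := set_elt D10; have [o2 _] := set_elt D20.
  (* With these choices $\Phi_1^{-1} \circ \Phi_2$ is exactly [k]. *)
  exists (max_space hD1), (max_space hD2), phi, (phi \o k).
  split; first by split; [exists | exists | |]; rewrite //; apply: max_space_ultrametric.
  split; rewrite ?distance_set_max_space //.
  + exact: max_space_weak_similarity.
  + by apply: max_space_weak_similarity => //; apply: bij_comp.
  exists psi; split=> // -[_ isom]; apply: kx; apply: val_inj.
  (* Since [k] fixes 0, an isometry would give $d(0, kx) = d(0, x)$, that is $kx = x$. *)
  have [o o0 o_dist] := max_space_zero hD1 D10.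
  have ko : k o = o.
    by apply: val_inj; rewrite o0; apply: (order_iso_val0 hD1 hD1 D10 k_bij).
  by have := isom o x; rewrite /comp !phiK ko !o_dist.
- move=> [X [Y [Phi1 [Phi2 [[X_inh Y_inh _ _] PhiP]]]]].
  by exists X, Y, Phi1, Phi2.
move=> [X [Y [Phi1 [Phi2 [_ [sim1 sim2 distX distY not_isom]]]]]].
subst D1 D2.
have [h h_aut h_fix] := weak_similarities_nontrivial_aut sim1 sim2 not_isom.
have [A1 [A2 [A3 [[sub1 sub2 sub3 A2_neq0] sumX]]]] :=
  nontrivial_aut_decomposition h_aut h_fix.
(* The decomposition was obtained for $D(X)$; either similarity transfers it to $D(Y)$. *)
have [F [F_bij F_mono _]] := weak_similarity_order_iso sim1.
have YX : order_iso (distance_set Y) (distance_set X) by exists F.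
exists A1, A2, A3; split.
  by split=> //; [move=> r /sub1/hD1 | move=> r /sub2/hD1 | move=> r /sub3/hD1].
split; first exact/tp_eqP/order_iso_sym.
rewrite sum3_ot_prodE; apply/tp_eqP.
exact: order_iso_trans YX (order_iso_sym sumX).
Qed.
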